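(* The compact-open topology on the homeomorphism group $H(M)$ of a compact manifold $M$ with non-trivial (that is, non-empty) boundary is not minimal.
   Context: $H(M)$ denotes the group of all homeomorphisms of $M$ onto itself under composition. A topology on a group is a group topology if the group operations are continuous for it. A Hausdorff group topology on a group is minimal if no strictly coarser group topology on the group is Hausdorff.
   Formalization: The manifold is assumed to have dimension at least 2; in dimension 1 the claim is false, since the compact-open topology on H([0,1]) is minimal (likewise for every compact 1-manifold with boundary), and in dimension 0 the boundary is empty. *)

(* Defs.v *)
From HB Require Import structures.
From mathcomp Require Import all_boot all_order all_algebra.
From mathcomp Require Import all_classical all_reals all_analysis.

Set Implicit Arguments.
Unset Strict Implicit.
Unset Printing Implicit Defensive.

Import Order.TTheory GRing.Theory Num.Theory.
Import numFieldNormedType.Exports.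

Local Open Scope classical_set_scope.
Local Open Scope ring_scope.

Record topology (T : Type) := Topology {
  opens : set_system T ;
  opensT : opens setT ;
  opensI : setI_closed opens ;
  opens_bigU : forall (I : Type) (f : I -> set T),
    (forall i, opens (f i)) -> opens (\bigcup_i f i) }.

(** [with_topology t] is [T] seen as a topological space with open sets
    [opens t], so that [continuous] and [hausdorff_space] apply to [t]. *)
Definition with_topology (T : choiceType) (t : topology T) : Type := T.

HB.instance Definition _ (T : choiceType) (t : topology T) :=
  Choice.on (with_topology t).
HB.instance Definition _ (T : choiceType) (t : topology T) :=
  isOpenTopological.Build (with_topology t)
    (@opensT T t) (@opensI T t) (@opens_bigU T t).

Definition strictly_coarser (T : Type) (s t : topology T) : Prop :=
  opens s `<` opens t.

Definition group_topology (G : groupType) (t : topology G) : Prop :=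
  continuous (fun p : with_topology t * with_topology t =>
    ((p.1 : G) * (p.2 : G))%g : with_topology t) /\
  continuous (fun x : with_topology t => ((x : G)^-1)%g : with_topology t).

Definition hausdorff_group_topology (G : groupType) (t : topology G) : Prop :=
  group_topology t /\ hausdorff_space (with_topology t).

Definition minimal_group_topology (G : groupType) (t : topology G) : Prop :=
  hausdorff_group_topology t /\
  ~ exists s : topology G, hausdorff_group_topology s /\ strictly_coarser s t.

Record homeo (M : topologicalType) := Homeo {
  hfun :> M -> M ;
  hinv : M -> M ;
  hfun_continuous : continuous hfun ;
  hinv_continuous : continuous hinv ;
  hfunK : cancel hfun hinv ;
  hinvK : cancel hinv hfun }.

HB.instance Definition _ (M : topologicalType) := gen_eqMixin (homeo M).
HB.instance Definition _ (M : topologicalType) := gen_choiceMixin (homeo M).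

Lemma homeo_ext (M : topologicalType) (f g : homeo M) :
  (forall x, f x = g x) -> f = g.
Proof.
case: f g => [f f' cf cf' fK f'K] [g g' cg cg' gK g'K] /= /funext fg.
subst g; have f'g' : f' = g' by apply/funext => x; rewrite -[x in LHS]g'K fK.
subst g'; congr Homeo; exact: Prop_irrelevance.
Qed.

Section homeo_group.
Context {M : topologicalType}.
Implicit Types f g : homeo M.

Definition homeo_one : homeo M :=
  @Homeo M id id (fun=> cvg_id) (fun=> cvg_id) (fun=> erefl) (fun=> erefl).

Definition homeo_inv f : homeo M :=
  Homeo (@hinv_continuous M f) (@hfun_continuous M f) (@hinvK M f) (@hfunK M f).

Definition homeo_mul f g : homeo M :=
  @Homeo M (f \o g) (hinv g \o hinv f)
    (fun x => continuous_comp (hfun_continuous (x := x))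
                              (hfun_continuous (x := g x)))
    (fun x => continuous_comp (hinv_continuous (x := x))
                              (hinv_continuous (x := hinv f x)))
    (can_comp (@hfunK M f) (@hfunK M g))
    (can_comp (@hinvK M g) (@hinvK M f)).

Let homeo_mulA : associative homeo_mul.
Proof. by move=> f g h; apply: homeo_ext. Qed.
Let homeo_mul1 : left_id homeo_one homeo_mul.
Proof. by move=> f; apply: homeo_ext. Qed.
Let homeo_1mul : right_id homeo_one homeo_mul.
Proof. by move=> f; apply: homeo_ext. Qed.
Let homeo_mulV : left_inverse homeo_one homeo_inv homeo_mul.
Proof. by move=> f; apply: homeo_ext => x; exact: hfunK. Qed.
Let homeo_Vmul : right_inverse homeo_one homeo_inv homeo_mul.
Proof. by move=> f; apply: homeo_ext => x; exact: hinvK. Qed.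

HB.instance Definition _ := isGroup.Build (homeo M)
  homeo_mulA homeo_mul1 homeo_1mul homeo_mulV homeo_Vmul.

End homeo_group.

(** The compact-open topology on H(M): the topology induced by the inclusion of
    H(M) in the space of all maps M -> M. *)

Section compact_open_topology.
Variable M : topologicalType.

Let open_co : set_system (homeo M) :=
  @open (initial_topology (@hfun M : homeo M -> {compact-open, M -> M})).

Let open_coT : open_co setT. Proof. exact: openT. Qed.
Let open_coI : setI_closed open_co. Proof. by move=> A B; exact: openI. Qed.
Let open_co_bigU (I : Type) (f : I -> set (homeo M)) :
  (forall i, open_co (f i)) -> open_co (\bigcup_i f i).
Proof. by move=> fo; apply: bigcup_open => i _; exact: fo. Qed.

Definition compact_open_topology : topology (homeo M) :=
  Topology open_coT open_coI open_co_bigU.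

End compact_open_topology.

Section compact_open_topology_theory.
Variable M : topologicalType.
Context (hM : hausdorff_space M) (cM : compact [set: M]).
Local Notation co := (compact_open_topology M).
Local Notation H := (with_topology co).

Lemma compact_open_topology_cvg (F : set_system H) (f : H) : Filter F ->
  (forall K O : set M, compact K -> open O -> (f : homeo M) @` K `<=` O ->
    F [set g : H | (g : homeo M) @` K `<=` O]) -> F --> f.
Proof.
move=> FF KO A fA; have : nbhs f A := fA.
rewrite nbhsE => -[_ [[C oC <-] Cf] CA].
apply: filterS CA _.
have /(_ C) : ((fun g : H => (g : homeo M) : {compact-open, M -> M}) @ F)
    --> ((f : homeo M) : {compact-open, M -> M}).
  by apply/compact_open_cvgP => K O cK oO fK; exact: KO.
by apply; exact: open_nbhs_nbhs.
Qed.

Lemma compact_open_topology_nbhs (f : H) (K O : set M) : compact K -> open O ->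
  (f : homeo M) @` K `<=` O ->
  nbhs f [set g : H | (g : homeo M) @` K `<=` O].
Proof.
move=> cK oO fK; apply: open_nbhs_nbhs; split=> //.
by exists ([set g | g @` K `<=` O] : set {compact-open, M -> M}) => //;
  exact: compact_open_open.
Qed.

Lemma compact_open_hausdorff_group_topology : hausdorff_group_topology co.
Proof.
split; first split.
- case=> f g; apply: compact_open_topology_cvg => K O cK oO fgK /=.
  have clK : closed K by exact: compact_closed.
  have oV : open ((f : homeo M) @^-1` O).
    by move/continuousP: (@hfun_continuous M f); exact.
  have gK : (g : homeo M) @` K `<=` (f : homeo M) @^-1` O.
    by move=> _ [x Kx <-]; apply: fgK; exists x.
  have cgK : compact ((g : homeo M) @` K).
    by apply: continuous_compact => //; apply: continuous_subspaceT;
      exact: hfun_continuous.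
  have sO : set_nbhs ((g : homeo M) @` K) ((f : homeo M) @^-1` O).
    by apply/set_nbhsP; exists ((f : homeo M) @^-1` O); split.
  have [L /set_nbhsP[N [oN gN NL]] LO] :=
      compact_normal hM cM (compact_closed hM cgK) sO.
  have cL : compact (closure L).
    by apply: (subclosed_compact _ cM) => //; exact: closed_closure.
  exists ([set h : H | (h : homeo M) @` closure L `<=` O],
          [set h : H | (h : homeo M) @` K `<=` N]) => /=.
    by split; apply: compact_open_topology_nbhs => // _ [x /LO Lx <-].
  move=> [u v] /= [uO vN] _ [x Kx <-] /=.
  apply: uO; exists ((v : homeo M) x) => //.
  by apply/subset_closure/NL/vN; exists x.
- move=> f; apply: compact_open_topology_cvg; first exact/fmap_filter/nbhs_filter.
  move=> K O cK oO fK /=.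
  have clK : closed K by exact: compact_closed.
  have cO : compact (~` O).
    by apply: (subclosed_compact _ cM) => //; exact: open_closedC.
  have inv_sub (h : homeo M) : hinv h @` K `<=` O <-> h @` (~` O) `<=` ~` K.
    split=> [hK _ [x Ox <-] Khx|hO _ [x Kx <-]].
      by apply: Ox; apply: hK; exists (h x) => //; rewrite /= hfunK.
    apply: contrapT => Ox; apply: (hO x) => //.
    by exists (hinv h x) => //; exact: hinvK.
  have := compact_open_topology_nbhs cO (closed_openC clK) ((inv_sub f).1 fK).
  apply: filterS => h /=.
  by move/(inv_sub h).
- rewrite open_hausdorff => f g fg.
  have [x fgx] : exists x, (f : homeo M) x != (g : homeo M) x.
    apply: contrapT => /forallNP fgE; move/eqP: fg; apply; apply: homeo_ext => x.
    by apply/eqP; apply: contrapT => /negP; exact: fgE.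
  have := hM; rewrite open_hausdorff => /(_ _ _ fgx)[[A B] /= [+ +] [oA oB AB]].
  rewrite !inE => Af Bg.
  exists ([set h : H | A ((h : homeo M) x)], [set h : H | B ((h : homeo M) x)]).
    by rewrite !inE.
  have pt_open (C : set M) : open C ->
      open [set h : H | C ((h : homeo M) x)].
    move=> oC; exists ([set h | h @` [set x] `<=` C] : set {compact-open, M -> M}).
      exact: (compact_open_open (@compact_set1 _ x)).
    by apply/seteqP; split=> h /= => [|Ch _ [_ -> <-] //]; apply; exists x.
  split; [exact: pt_open|exact: pt_open|].
  apply/eqP/seteqP; split=> // h /= [Ah Bh].
  by move/eqP: AB => AB; have : (A `&` B) ((h : homeo M) x) by []; rewrite AB.
Qed.

End compact_open_topology_theory.

(** [A] and [B], with their subspace topologies, are homeomorphic. *)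
Definition homeomorphic_sets (X Y : topologicalType) (A : set X) (B : set Y) :=
  exists (f : X -> Y) (g : Y -> X),
    [/\ f @` A = B, {within A, continuous f}, {within B, continuous g} &
        forall x, A x -> g (f x) = x].

Section manifold.
Variables (R : realType) (n : nat) (M : topologicalType).

(** The closed half-space of the vectors of R^n whose first coordinate is nonnegative. *)
Definition half_space : set 'rV[R]_n :=
  [set v | forall i : 'I_n, i = 0%N :> nat -> 0 <= v ord0 i].

Definition manifold_with_boundary : Prop :=
  [/\ hausdorff_space M, @second_countable M &
      forall x : M, exists (U : set M) (W : set 'rV[R]_n),
        [/\ open_nbhs x U, open W & homeomorphic_sets U (W `&` half_space)]].

Definition manifold_interior : set M :=
  [set x | exists (U : set M) (W : set 'rV[R]_n),
     [/\ open_nbhs x U, open W & homeomorphic_sets U W]].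

(** The boundary is the set of the points without Euclidean neighbourhood. *)
Definition manifold_boundary : set M := ~` manifold_interior.

End manifold.

Arguments half_space R n : clear implicits.
Arguments manifold_with_boundary R n M : clear implicits.
Arguments manifold_interior R n M : clear implicits.
Arguments manifold_boundary R n M : clear implicits.

(* Main.v *)
Require Import Defs.
From mathcomp Require Import all_boot all_order all_algebra.
From mathcomp Require Import all_classical all_reals all_analysis.
From mathcomp Require Import ring lra.
Import Order.TTheory GRing.Theory Num.Theory.
Import numFieldNormedType.Exports.

(** Let [B] be the boundary of [M].  Every homeomorphism of [M] preserves [B],
    so [H(M)] acts on the quotient [M/B] in which [B] is collapsed to a point.
    The interior of [M] is dense, hence this action is faithful, and the
    compact-open topology of [H(M/B)] restricts to a Hausdorff group topology on
    [H(M)] which is coarser than the compact-open topology of [M].  It is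
    strictly coarser because it does not see motions along the boundary: there
    are two points [p <> q] of [B] such that, however small a neighbourhood [O]
    of [B] is, some homeomorphism supported in [O] moves [p] to [q].  On [M/B]
    these homeomorphisms converge to the identity, on [M] they do not.

    All of this can be said in terms of [M].  The compact-open topology of
    [H(M/B)] is that of uniform convergence, and the uniformity of [M/B] is
    generated by the continuous pseudometrics on [M] that vanish on [B * B]; so
    [collapsed_topology] is defined as uniform convergence with respect to these.
    The group axioms are then triangle inequalities
    ([collapsed_group_topology]), Urysohn's lemma gives separation
    ([collapsed_hausdorff]), and compactness gives the comparison with the
    compact-open topology ([collapsed_coarser]).

    The homeomorphisms are built in a chart with values in a half-space of
    dimension at least 2.  Near a given point, [push] slides points along a
    coordinate axis tangent to the face of the half-space, by an amount that
    depends on the distance to that axis and vanishes outside a thin box around a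
    segment of it.  It is extended by the identity outside of the chart
    ([chart_extension]).

    For the box to lie in a given neighbourhood of [B] when it is thin enough, the
    segment must consist of boundary points, that is, of points without Euclidean
    neighbourhood.  This comes from homogeneity: homeomorphisms preserve the
    boundary, so pushing one boundary point along the axis by varying amounts
    yields a segment of boundary points ([boundary_segment]).  A second push,
    centred in the middle of this segment, can then be squeezed against [B]
    ([boundary_push]). *)

Set Implicit Arguments.
Unset Strict Implicit.
Unset Printing Implicit Defensive.

Local Open Scope classical_set_scope.
Local Open Scope ring_scope.

(** * Uniform convergence modulo a collapsed subset *)

Section collapsed_topology.
Context (R : realType) (M : topologicalType) (B : set M).
Implicit Types (d : M -> M -> R) (f g h : homeo M).

(** These are the continuous pseudometrics of the quotient [M/B]. *)
Definition collapsing_pseudometric d : Prop :=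
  [/\ forall x, d x x = 0, forall x y, d x y = d y x,
      forall x y z, d x z <= d x y + d y z,
      forall x, continuous (d x) &
      forall x y, B x -> B y -> d x y = 0].

Definition uniform_ball d (e : R) f : set (homeo M) :=
  [set g | forall x, d (f x) (g x) < e].

Let collapsed_open : set_system (homeo M) := [set U | forall f, U f ->
  exists d e, [/\ collapsing_pseudometric d, 0 < e & uniform_ball d e f `<=` U]].

Lemma collapsing_pseudometric0 : collapsing_pseudometric (fun _ _ => 0).
Proof. by split=> // *; rewrite ?addr0//; exact: cst_continuous. Qed.

Lemma collapsing_pseudometricD d1 d2 :
  collapsing_pseudometric d1 -> collapsing_pseudometric d2 ->
  collapsing_pseudometric (fun x y => d1 x y + d2 x y).
Proof.
move=> [d1_0 d1C d1_tri d1_cont d1B] [d2_0 d2C d2_tri d2_cont d2B]; split.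
- by move=> x; rewrite d1_0 d2_0 addr0.
- by move=> x y; rewrite d1C d2C.
- by move=> x y z; rewrite addrACA lerD.
- by move=> x y; apply: cvgD; [exact: d1_cont|exact: d2_cont].
- by move=> x y Bx By; rewrite d1B// d2B// addr0.
Qed.

Lemma collapsing_pseudometric_ge0 d x y : collapsing_pseudometric d -> 0 <= d x y.
Proof.
by move=> [d0 dC d_tri _ _]; have := d_tri x y x; rewrite d0 (dC y x); lra.
Qed.

Let collapsed_openT : collapsed_open setT.
Proof.
by move=> f _; exists (fun _ _ => 0), 1; split=> //; exact: collapsing_pseudometric0.
Qed.

Let collapsed_openI : setI_closed collapsed_open.
Proof.
move=> U V Uo Vo f [/Uo[d1 [e1 [cd1 e10 fU]]] /Vo[d2 [e2 [cd2 e20 fV]]]].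
exists (fun x y => d1 x y + d2 x y), (Num.min e1 e2); split.
- exact: collapsing_pseudometricD.
- by rewrite lt_min e10.
- move=> g fg; split.
    apply: fU => x; have := fg x; rewrite lt_min => /andP[+ _]; apply: le_lt_trans.
    by rewrite lerDl collapsing_pseudometric_ge0.
  apply: fV => x; have := fg x; rewrite lt_min => /andP[_]; apply: le_lt_trans.
  by rewrite lerDr collapsing_pseudometric_ge0.
Qed.

Let collapsed_open_bigU (I : Type) (F : I -> set (homeo M)) :
  (forall i, collapsed_open (F i)) -> collapsed_open (\bigcup_i F i).
Proof.
move=> Fo f [i _ /Fo[d [e [cd e0 fF]]]]; exists d, e; split=> //.
by move=> g /fF; exists i.
Qed.

Definition collapsed_topology : topology (homeo M) :=
  Topology collapsed_openT collapsed_openI collapsed_open_bigU.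

Local Notation H := (with_topology collapsed_topology).

(** The uniform ball of radius [e] need not be open, since its defining
    inequality is only pointwise: the union of the balls of smaller radius is. *)
Lemma collapsed_nbhs d e (f : H) : collapsing_pseudometric d -> 0 < e ->
  nbhs f (uniform_ball d e f : set H).
Proof.
move=> cd e0; have [d0 _ d_tri _ _] := cd; rewrite nbhsE.
exists [set g : H | exists2 e', e' < e & uniform_ball d e' f g]; last first.
  by move=> g [e' e'e fg] x; exact: lt_trans (fg x) e'e.
split; last by exists (e / 2) => [|x]; rewrite ?d0 ?divr_gt0//; lra.
move=> g [e' e'e fg]; exists d, ((e - e') / 2); split=> // [|h gh].
  by rewrite divr_gt0// subr_gt0.
exists ((e + e') / 2) => [|x]; first lra.
by have := d_tri (f x) (g x) (h x); have := fg x; have := gh x; lra.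
Qed.

Lemma collapsed_cvg (F : set_system H) (f : H) : Filter F ->
  (forall d e, collapsing_pseudometric d -> 0 < e ->
     F (uniform_ball d e f : set H)) -> F --> f.
Proof.
move=> FF Ff A fA; have : nbhs f A := fA.
rewrite nbhsE => -[U [oU Uf] UA]; apply: filterS UA _.
have [d [e [cd e0 fU]]] := oU _ Uf.
by apply: filterS fU _; exact: Ff.
Qed.

Lemma collapsing_pseudometric_comp d f : (forall x, B x -> B (f x)) ->
  collapsing_pseudometric d -> collapsing_pseudometric (fun x y => d (f x) (f y)).
Proof.
move=> fB [d0 dC d_tri d_cont dB]; split=> //.
- move=> x y; apply: (continuous_comp (g := d (f x))); last exact: d_cont.
  exact: hfun_continuous.
- by move=> x y Bx By; apply: dB; exact: fB.
Qed.

(** Invariance of [B] makes the class of collapsing pseudometrics stable under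
    pullback by homeomorphisms, as the continuity of the group operations
    requires. *)
Hypothesis homeoB : forall f x, B x -> B (f x).

(** For the product, [d (f (g x)) (u (v x))] is at most
    [d (f (g x)) (f (v x)) + d (f (v x)) (u (v x))], where the first term is the
    distance from [g x] to [v x] for the pullback of [d] by [f].  For the inverse,
    with [y] the preimage of [x] under [g], [d (hinv g x) (hinv f x)] is the
    distance from [g y] to [f y] for the pullback of [d] by [hinv f]. *)
Lemma collapsed_group_topology : group_topology collapsed_topology.
Proof.
split.
- case=> f g; apply: collapsed_cvg => d e cd e0.
  have [_ _ d_tri _ _] := cd.
  have e20 : 0 < e / 2 by rewrite divr_gt0.
  exists (uniform_ball d (e / 2) f,
          uniform_ball (fun x y => d ((f : homeo M) x) ((f : homeo M) y)) (e / 2) g).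
    split; apply: collapsed_nbhs => //.
    exact: collapsing_pseudometric_comp (homeoB f) cd.
  move=> [u v] /= [fu gv] x; rewrite /=.
  have := d_tri ((f : homeo M) ((g : homeo M) x))
    ((f : homeo M) ((v : homeo M) x)) ((u : homeo M) ((v : homeo M) x)).
  by have := fu ((v : homeo M) x); have := gv x; rewrite /=; lra.
- move=> f; apply: collapsed_cvg; first exact/fmap_filter/nbhs_filter.
  move=> d e cd e0; have [_ dC _ _ _] := cd.
  have := collapsed_nbhs f
    (collapsing_pseudometric_comp (homeoB (homeo_inv f)) cd) e0.
  apply: filterS => g /= fg x.
  by have := fg (hinv g x); rewrite /= dC hfunK hinvK.
Qed.

(** Around each [x], the homeomorphism [f] moves little on a compact neighbourhood
    [K] of [x], and sending [K] close to [f x] is a condition of the compact-open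
    topology; finitely many such [K] cover [M]. *)
Lemma collapsed_coarser : compact [set: M] ->
  opens collapsed_topology `<=` opens (compact_open_topology M).
Proof.
move=> cM U oU.
suff : open (U : set (with_topology (compact_open_topology M))) by [].
rewrite openE => f /oU[d [e [cd e0 fU]]].
have [d0 dC d_tri d_cont _] := cd.
have cover : near_covering [set: M] by exact/compact_near_coveringP.
pose Co := with_topology (compact_open_topology M).
have /(cover Co (nbhs (f : Co)) (fun g x => d (f x) ((g : homeo M) x) < e)) :
    forall x, [set: M] x -> \forall x' \near x & g \near (f : Co),
      d (f x') ((g : homeo M) x') < e.
  move=> x _; pose K := [set z | d (f x) (f z) <= e / 3].
  have dfx_cont : continuous (fun z => d (f x) (f z)).
    move=> z; apply: (continuous_comp (g := d (f x))); last exact: d_cont.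
    exact: hfun_continuous.
  have cK : compact K.
    apply: (subclosed_compact _ cM) => //.
    exact: ((continuous_closedP _).1 dfx_cont _ (closed_le (y := e / 3))).
  have oO : open [set y | d (f x) y < e / 2].
    exact: ((continuousP _).1 (d_cont (f x)) _ (open_lt (y := e / 2))).
  exists (K, [set g : Co | (g : homeo M) @` K `<=` [set y | d (f x) y < e / 2]]).
    split => /=; last first.
      apply: compact_open_topology_nbhs => // _ [z Kz <-] /=.
      by move: Kz; rewrite /K /=; lra.
    have : nbhs x ((fun z => d (f x) (f z)) @^-1` [set t | t < e / 3]).
      apply: open_nbhs_nbhs; split; last by rewrite /= d0 divr_gt0.
      exact: ((continuousP _).1 dfx_cont _ (open_lt (y := e / 3))).
    by apply: filterS => z; exact: ltW.
  move=> [z g] /= [Kz gK].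
  have /gK /= : ((g : homeo M) @` K) ((g : homeo M) z) by exists z.
  have := d_tri (f z) (f x) ((g : homeo M) z).
  by move: Kz; rewrite /K /= (dC (f z) (f x)); lra.
by apply: filterS => g /= fg; apply: fU => x; exact: fg.
Qed.

(** Distinct [f] and [g] already differ at a point [x] outside of [B], as the
    complement of [B] is dense.  Since [f x] is not in [B], Urysohn's lemma gives
    a function that separates it from [g x] and is constant on [B]. *)
Lemma collapsed_hausdorff : hausdorff_space M -> compact [set: M] ->
  closed B -> dense (~` B) -> hausdorff_space H.
Proof.
move=> hM cM clB dB f g fg; apply: contrapT => f_neq_g.
have [x Bx fgx] : exists2 x, ~ B x & (f : homeo M) x <> (g : homeo M) x.
  apply: contrapT => fgE; apply: f_neq_g; apply: homeo_ext => x.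
  apply: contrapT => fgx.
  have := hM; rewrite open_hausdorff => /(_ _ _ (introN eqP fgx)).
  move=> [[V W] /= [+ +] [oV oW VW]].
  rewrite !inE => Vf Wg.
  have : ([set z | V ((f : homeo M) z)] `&` [set z | W ((g : homeo M) z)]) !=set0.
    by exists x.
  move=> /dB; case.
    by apply: openI; [move/continuousP : (@hfun_continuous M f)|
      move/continuousP : (@hfun_continuous M g)]; exact.
  move=> z [[Vz Wz] Bz]; apply: fgE; exists z => // fgz.
  suff : set0 ((f : homeo M) z) by [].
  by move/eqP : VW => <-; split=> //; rewrite fgz.
have Bfx : ~ B ((f : homeo M) x).
  by move/(homeoB (homeo_inv f)); rewrite /= hfunK.
have sep := (normal_separatorP (R := R)).1 (compact_normal hM cM).
have clpt (z : M) : closed [set z].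
  exact: (accessible_closed_set1 (hausdorff_accessible hM)).
have /(uniform_separatorP (R := R))[phi [phi_cont _ phi0 phi1]] :
    @uniform_separator M [set (f : homeo M) x] (B `|` [set (g : homeo M) x]).
  apply: sep; [exact: clpt|exact: (closedU clB (clpt _))|].
  by apply/seteqP; split=> // z [-> [/Bfx|/fgx]].
pose d y z := `|phi y - phi z|.
have cd : collapsing_pseudometric d.
  split.
  - by move=> y; rewrite /d subrr normr0.
  - by move=> y z; rewrite /d distrC.
  - by move=> y z t; rewrite /d; exact: ler_distD.
  - move=> y z; apply: cvg_norm; apply: cvgB; first exact: cvg_cst.
    exact: phi_cont.
  - move=> y z By Bz; have phiB t : B t -> phi t = 1.
      by move=> Bt; apply: phi1; exists t => //; left.
    by rewrite /d !phiB// subrr normr0.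
have phif : phi ((f : homeo M) x) = 0 by apply: phi0; exists ((f : homeo M) x).
have phig : phi ((g : homeo M) x) = 1.
  by apply: phi1; exists ((g : homeo M) x) => //; right.
have e0 : 0 < 2^-1 :> R by rewrite invr_gt0.
have [h [/(_ x) fh /(_ x) gh]] :=
  fg _ _ (collapsed_nbhs f cd e0) (collapsed_nbhs g cd e0).
have := ler_distD (phi ((h : homeo M) x))
  (phi ((f : homeo M) x)) (phi ((g : homeo M) x)).
move: fh gh; rewrite /d (distrC (phi ((g : homeo M) x))) phif phig.
rewrite (sub0r 1) normrN normr1; lra.
Qed.

(** The homeomorphisms that do not move [p] to [q] form a neighbourhood of the
    identity in the compact-open topology.  They do not in the collapsed one: a
    pseudometric that vanishes on [B * B] is small on a neighbourhood [O] of [B],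
    and so does not distinguish a homeomorphism supported in [O] from the
    identity. *)
Lemma collapsed_strictly_coarser (p q : M) :
  hausdorff_space M -> compact [set: M] -> B p -> p <> q ->
  (forall O : set M, open O -> B `<=` O -> exists2 h : homeo M, h p = q &
     forall x, h x = x \/ O x /\ O (h x)) ->
  strictly_coarser collapsed_topology (compact_open_topology M).
Proof.
move=> hM cM Bp pq push; split; first exact: collapsed_coarser.
pose A : set (homeo M) := [set g | g p <> q].
have : opens (compact_open_topology M) A.
  suff : open (A : set (with_topology (compact_open_topology M))) by [].
  rewrite openE => f fp.
  have : nbhs (f : with_topology (compact_open_topology M))
      [set g : with_topology _ | (g : homeo M) @` [set p] `<=` ~` [set q]].
    apply: compact_open_topology_nbhs; first exact: compact_set1.
      by apply: closed_openC; exact: (accessible_closed_set1 (hausdorff_accessible hM)).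
    by move=> _ [_ -> <-].
  by apply: filterS => g /= gA; apply: gA; exists p.
move=> /[swap] /[apply] /(_ 1%g)[]; first exact: pq.
move=> d [e [cd e0 dA]]; have [d0 dC d_tri d_cont dB] := cd.
have [] := push [set y | d p y < e / 2].
- exact: ((continuousP _).1 (d_cont p) _ (open_lt (y := e / 2))).
- by move=> b Bb; rewrite /= dB// divr_gt0.
- move=> h hpq hO; apply: (dA h) hpq => x /=.
  have [->|[/= Ox Ohx]] := hO x; first by rewrite d0.
  by have := d_tri x p (h x); rewrite (dC x p); lra.
Qed.

End collapsed_topology.

(** * A compactly supported push along an axis *)

Section slide.
Context {R : realFieldType}.
Implicit Types r t s u : R.

(** For [0 <= t], [slide r t] is an increasing piecewise linear bijection of the
    line, namely [s |-> s + max 0 (min t ((r - |s|) / 2))]: it translates by [t]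
    near the centre of [[-r, r]] if [t < r / 2], and fixes all points outside of
    this interval.  As a maximum and minimum of increasing affine functions, it has
    as inverse the minimum and maximum of their inverses. *)
Definition slide r t s :=
  Num.max s (Num.min (s + t) (Num.min ((s + r) / 2) ((3 * s + r) / 2))).

Definition slide_inv r t u :=
  Num.min u (Num.max (u - t) (Num.max (2 * u - r) ((2 * u - r) / 3))).

Lemma slideK r t : 0 <= t -> cancel (slide r t) (slide_inv r t).
Proof.
move=> t0 s; rewrite /slide /slide_inv.
by case: (leP ((s + r) / 2)) => ?; case: (leP (s + t)) => ?; case: (leP s) => ?;
  case: (leP (2 * _ - r)) => ?; case: (leP (_ - t)) => ?; case: leP => ?; lra.
Qed.

Lemma slide_invK r t : 0 <= t -> cancel (slide_inv r t) (slide r t).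
Proof.
move=> t0 u; rewrite /slide /slide_inv.
by case: (leP (2 * u - r)) => ?; case: (leP (u - t)) => ?; case: (leP u) => ?;
  case: (leP ((_ + r) / 2)) => ?; case: (leP (_ + t)) => ?; case: leP => ?; lra.
Qed.

Lemma slide_out r t s : 0 <= t -> r < `|s| -> slide r t s = s.
Proof.
move=> t0; rewrite /slide ltr_normr => /orP[] rs;
by case: (leP ((s + r) / 2)) => ?; case: (leP (s + t)) => ?; case: (leP s) => ?; lra.
Qed.

Lemma slide0 r s : slide r 0 s = s.
Proof.
rewrite /slide.
by case: (leP ((s + r) / 2)) => ?; case: (leP (s + 0)) => ?; case: (leP s) => ?; lra.
Qed.

Lemma slide_center r t : 0 <= t <= r / 2 -> slide r t 0 = t.
Proof.
move=> /andP[t0 tr]; rewrite /slide.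
by case: (leP ((0 + r) / 2)) => ?; case: (leP (0 + t)) => ?; case: (leP 0) => ?; lra.
Qed.

End slide.

Section local_push.
Context {R : realType} {n : nat} (i1 : 'I_n) (v : 'rV[R]_n) (r sigma kappa : R).
Implicit Types w : 'rV[R]_n.

Let e : 'rV[R]_n := delta_mx ord0 i1.

(** [axial] and [radial] are cylindrical coordinates around the line through [v] in
    the direction of the coordinate [i1]. *)
Definition axial w : R := w ord0 i1 - v ord0 i1.
Definition radial w : R := `|w - v - axial w *: e|.
(** [sigma] is the value on the axis, and [kappa] the slope at which the height
    decreases away from it. *)
Definition height w : R := Num.max 0 (sigma - kappa * radial w).

(** On each line parallel to the axis, [push] is the bijection [slide r t] for a
    [t] that is constant along the line, hence it is bijective. *)
Definition push w := w + (slide r (height w) (axial w) - axial w) *: e.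
Definition push_inv w := w + (slide_inv r (height w) (axial w) - axial w) *: e.

Lemma axialD w s : axial (w + s *: e) = axial w + s.
Proof. by rewrite /axial !mxE !eqxx mulr1 addrAC. Qed.

Lemma radialD w s : radial (w + s *: e) = radial w.
Proof.
by rewrite /radial axialD scalerDl (addrAC w) opprD addrACA subrr addr0.
Qed.

Lemma height_ge0 w : 0 <= height w.
Proof. by rewrite le_max lexx. Qed.

Lemma heightD w s : height (w + s *: e) = height w.
Proof. by rewrite /height radialD. Qed.

Lemma pushK : cancel push push_inv.
Proof.
move=> w; rewrite /push_inv heightD axialD /push -addrA -scalerDl.
rewrite (addrC (axial w)) subrK slideK ?height_ge0//.
by rewrite [X in X *: _](_ : _ = 0) ?scale0r ?addr0//; ring.
Qed.

Lemma push_invK : cancel push_inv push.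
Proof.
move=> w; rewrite /push heightD axialD /push_inv -addrA -scalerDl.
rewrite (addrC (axial w)) subrK slide_invK ?height_ge0//.
by rewrite [X in X *: _](_ : _ = 0) ?scale0r ?addr0//; ring.
Qed.

Lemma axial_continuous : continuous axial.
Proof.
move=> w; apply: continuousB; first exact: coord_continuous.
exact: cst_continuous.
Qed.

Lemma radial_continuous : continuous radial.
Proof.
move=> w; apply: (continuous_comp (f := fun w => w - v - axial w *: e) (g := Num.norm)).
  apply: (continuousB (f := fun w => w - v) (g := fun w => axial w *: e)).
    apply: (continuousB (f := id) (g := cst v)); last exact: cst_continuous.
    exact: cvg_id.
  by apply: continuousZr_tmp; exact: axial_continuous.
exact: norm_continuous.
Qed.

Lemma height_continuous : continuous height.
Proof.
move=> w; apply: (@continuous_max R _ (cst 0) (fun w => sigma - kappa * radial w)).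
  exact: cst_continuous.
apply: (continuousB (f := cst sigma) (g := fun w => kappa * radial w)).
  exact: cst_continuous.
by apply: continuousM; [exact: cst_continuous|exact: radial_continuous].
Qed.

Lemma push_continuous : continuous push.
Proof.
have ac := axial_continuous.
have cst_cont c : continuous (cst c : 'rV[R]_n -> R) by exact: cst_continuous.
move=> w; apply: (continuousD (f := id)); first exact: cvg_id.
apply: continuousZr_tmp.
apply: (continuousB (g := axial)); last exact: ac.
apply: (@continuous_max R _ axial); first exact: ac.
apply: (@continuous_min R _ (fun w => axial w + height w)).
  by apply: continuousD; [exact: ac|exact: height_continuous].
apply: (@continuous_min R _ (fun w => (axial w + r) / 2)).
  apply: (continuousM (t := cst 2^-1)); last exact: cst_cont.
  by apply: (continuousD (g := cst r)); [exact: ac|exact: cst_cont].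
apply: (continuousM (t := cst 2^-1)); last exact: cst_cont.
apply: (continuousD (f := fun w => 3 * axial w) (g := cst r)); last exact: cst_cont.
by apply: continuousM; [exact: cst_cont|exact: ac].
Qed.

Definition push_box : set 'rV[R]_n :=
  [set w | kappa * radial w <= sigma /\ `|axial w| <= r].

Lemma push_out w : ~ push_box w -> push w = w.
Proof.
move=> wbox; rewrite /push; suff -> : slide r (height w) (axial w) = axial w.
  by rewrite subrr scale0r addr0.
have [rw|rw] := ltP r `|axial w|; first by rewrite slide_out ?height_ge0.
rewrite /height max_l ?slide0// subr_le0 leNgt; apply/negP => /ltW sw.
exact: wbox.
Qed.

(** Taking for [sigma] any number of [[0, r / 2]] makes [push] move its centre to
    any point of a segment of the axis. *)
Lemma push_center : 0 <= sigma <= r / 2 -> push v = v + sigma *: e.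
Proof.
move=> sr; have av : axial v = 0 by rewrite /axial subrr.
have rv : radial v = 0 by rewrite /radial av scale0r !subrr normr0.
rewrite /push /height av rv mulr0 !subr0 max_r; last by case/andP: sr.
by rewrite slide_center.
Qed.

Lemma push_other w (i : 'I_n) : i != i1 -> push w ord0 i = w ord0 i.
Proof. by move=> ii1; rewrite !mxE (negbTE ii1) andbF mulr0 addr0. Qed.

Lemma norm_radial w (s : R) : `|axial w| <= s -> `|w - v| <= radial w + s * `|e|.
Proof.
move=> ws; rewrite -[w - v](subrK (axial w *: e)).
by apply: le_trans (ler_normD _ _) _; rewrite lerD// normrZ ler_wpM2r.
Qed.

Lemma push_box_compact : 0 < kappa -> compact push_box.
Proof.
move=> k0; apply: bounded_closed_compact.
  exists (`|v| + (sigma / kappa + r * `|e|)); split; first exact: num_real.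
  move=> C Cb w [rw aw]; rewrite -[w](subrK v) addrC.
  apply: le_trans (ler_normD _ _) _; apply: le_trans (ltW Cb); rewrite lerD2l.
  apply: le_trans (norm_radial aw) _; rewrite lerD2r.
  by rewrite ler_pdivlMr// mulrC.
apply: closedI.
  apply: ((continuous_closedP (fun w => kappa * radial w)).1 _ _
    (closed_le (y := sigma))).
  move=> w; apply: (continuousM (s := cst kappa)); first exact: cst_continuous.
  exact: radial_continuous.
apply: ((continuous_closedP (fun w => `|axial w|)).1 _ _ (closed_le (y := r))).
move=> w; apply: (continuous_comp (f := axial) (g := Num.norm)).
  exact: axial_continuous.
exact: norm_continuous.
Qed.

End local_push.

(** * Homeomorphisms supported in a chart *)

(** A continuous bijection of a compact Hausdorff space is closed. *)
Lemma compact_bijection_homeo (M : topologicalType) (F G : M -> M) :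
  hausdorff_space M -> compact [set: M] ->
  continuous F -> cancel F G -> cancel G F ->
  exists h : homeo M, h = F :> (M -> M).
Proof.
move=> hM cM cF FK GK; suff cG : continuous G by exists (Homeo cF cG FK GK).
apply/continuous_closedP => A clA.
have -> : G @^-1` A = F @` A.
  by apply/seteqP; split=> [x AGx|_ [x Ax <-]]; [exists (G x)|rewrite /= FK].
apply: (compact_closed hM); apply: continuous_compact.
  exact: continuous_subspaceT.
exact: (subclosed_compact clA cM).
Qed.

Lemma homeo_boundary (R : realType) (n : nat) (M : topologicalType) (h : homeo M) x :
  manifold_boundary R n M x -> manifold_boundary R n M (h x).
Proof.
move=> Bx [U [W [[oU Uhx] oW [f [g [fU fc gc fK]]]]]]; apply: Bx.
have oU' : open (h @^-1` U) by move/continuousP : (@hfun_continuous M h); exact.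
exists (h @^-1` U), W; split=> //; exists (f \o h), (hinv h \o g); split.
- rewrite -fU; apply/seteqP; split=> [_ [y Uy <-]|_ [y Uy <-]]; first by exists (h y).
  by exists (hinv h y); rewrite /= hinvK.
- rewrite continuous_open_subspace// => y; rewrite inE => Uy.
  apply: continuous_comp; first exact: hfun_continuous.
  by move: fc; rewrite continuous_open_subspace//; apply; rewrite inE.
- move: gc; rewrite !continuous_open_subspace// => gc y Wy.
  by apply: continuous_comp; [exact: gc|exact: hinv_continuous].
- by move=> y Uy; rewrite /= fK// hfunK.
Qed.

Lemma manifold_interior_open (R : realType) (n : nat) (M : topologicalType) :
  open (manifold_interior R n M).
Proof.
rewrite openE => x [U [W [[oU Ux] oW UW]]]; rewrite /interior nbhsE.
by exists U => // y Uy; exists U, W.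
Qed.

Record half_space_chart (R : realType) (n : nat) (M : topologicalType)
    (U : set M) (W : set 'rV[R]_n) (phi : M -> 'rV[R]_n) (psi : 'rV[R]_n -> M) :
    Prop := HalfSpaceChart {
  chart_open_dom : open U ;
  chart_open_codom : open W ;
  chart_onto : phi @` U = W `&` half_space R n ;
  chart_within_continuous : {within U, continuous phi} ;
  chart_inv_within_continuous : {within W `&` half_space R n, continuous psi} ;
  chartK : forall x, U x -> psi (phi x) = x }.

Lemma manifold_chart (R : realType) (n : nat) (M : topologicalType) (x : M) :
  manifold_with_boundary R n M -> exists U W phi psi,
    U x /\ @half_space_chart R n M U W phi psi.
Proof.
move=> [_ _ /(_ x)[U [W [[oU Ux] oW [phi [psi [? ? ? ?]]]]]]].
by exists U, W, phi, psi.
Qed.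

Section half_space_chart.
Context {R : realType} {n : nat} {M : topologicalType}.
Variables (i0 : 'I_n) (U : set M) (W : set 'rV[R]_n) (phi : M -> 'rV[R]_n)
  (psi : 'rV[R]_n -> M).
Hypotheses (i0E : i0 = 0%N :> nat) (UW : half_space_chart U W phi psi).

Lemma half_spaceE : half_space R n = [set w | 0 <= w ord0 i0].
Proof.
apply/seteqP; split=> w /=; first exact.
by move=> w0 i ii0; rewrite (_ : i = i0)//; apply: ord_inj; rewrite ii0 i0E.
Qed.

Lemma chart_image x : U x -> W (phi x) /\ half_space R n (phi x).
Proof.
by move=> Ux; have : (phi @` U) (phi x) by [exists x]; rewrite (chart_onto UW).
Qed.

Lemma chart_inv w : W w -> half_space R n w -> U (psi w) /\ phi (psi w) = w.
Proof.
move=> Ww hw; have : (phi @` U) w by rewrite (chart_onto UW).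
by move=> [x Ux <-]; rewrite (chartK UW).
Qed.

Lemma chart_continuous x : U x -> {for x, continuous phi}.
Proof.
have oU := chart_open_dom UW; have := chart_within_continuous UW.
by rewrite continuous_open_subspace// => phi_cont Ux; apply: phi_cont; rewrite inE.
Qed.

Lemma chart_inv_continuous w (A : set M) : W w -> half_space R n w ->
  nbhs (psi w) A -> \forall w' \near w, half_space R n w' -> A (psi w').
Proof.
move=> Ww hw Aw.
have near_w : nbhs w (fun w' => (W `&` half_space R n) w' -> A (psi w')) :=
  (subspace_continuousP _ _).1 (chart_inv_within_continuous UW) w (conj Ww hw) A Aw.
have nW : nbhs w W by apply: open_nbhs_nbhs; split=> //; exact: chart_open_codom UW.
by apply: filterS2 nW near_w => w' Ww' + hw'; exact.
Qed.

Lemma chart_interior x : U x -> 0 < phi x ord0 i0 -> manifold_interior R n M x.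
Proof.
have [oU oW _ phi_cont psi_cont phiK] := UW.
move=> Ux x0; pose P := [set w : 'rV[R]_n | 0 < w ord0 i0].
have oP : open P.
  apply: (continuousP (fun w : 'rV[R]_n => w ord0 i0)).1 (open_gt (y := 0)).
  exact: coord_continuous.
have hP w : P w -> half_space R n w by rewrite half_spaceE /= => /ltW.
have oUP : open (U `&` phi @^-1` P).
  rewrite openE => y [Uy Py]; apply: filterI; first exact: open_nbhs_nbhs.
  by apply: (chart_continuous Uy); exact: open_nbhs_nbhs.
exists (U `&` phi @^-1` P), (W `&` P); split=> //; first exact: openI.
exists phi, psi; split.
- apply/seteqP; split=> [_ [y [Uy Py] <-]|w [Ww Pw]].
    by have [] := chart_image Uy.
  have [Uw pw] := chart_inv Ww (hP _ Pw).
  by exists (psi w) => //; split=> //; rewrite /= pw.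
- by apply: (continuous_subspaceW _ phi_cont) => y [].
- by apply: (continuous_subspaceW _ psi_cont) => w [Ww /hP].
- by move=> y [Uy _]; exact: phiK.
Qed.

(** Extends a homeomorphism [h] of the model, supported in a compact set [K] inside
    of the chart, by the identity of [M].  The extension is continuous as the image
    [S] of [K] is closed in [M], so that [M] is covered by two open sets, [U] and
    the complement of [S], on each of which the extension is continuous.
    Preservation of the coordinate [i0] makes [h] act on the half-space. *)
Lemma chart_extension (h h' : 'rV[R]_n -> 'rV[R]_n) (K : set 'rV[R]_n) :
  hausdorff_space M -> compact [set: M] ->
  cancel h h' -> cancel h' h -> continuous h ->
  (forall w, h w ord0 i0 = w ord0 i0) ->
  compact K -> K `<=` W -> (forall w, ~ K w -> h w = w) ->
  exists F : homeo M, (forall w, W w -> half_space R n w -> F (psi w) = psi (h w)) /\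
    forall x, F x = x \/ exists w w',
      [/\ K w /\ half_space R n w, x = psi w, K w' /\ half_space R n w' & F x = psi w'].
Proof.
have [oU oW _ _ psi_cont phiK] := UW.
move=> hM cM hK h'K h_cont h_i0 cK KW h_out.
have hhalf w : half_space R n w -> half_space R n (h w).
  by rewrite half_spaceE /= h_i0.
(* A point that [h] sent out of [K] would have the same image as its image. *)
have hKK w : K w -> K (h w).
  move=> Kw; apply: contrapT => Khw; apply: (Khw).
  by rewrite (can_inj hK (h_out _ Khw)).
have hW w : W w -> W (h w).
  have [/hKK/KW//|/h_out -> //] := pselect (K w).
have h'_out w : ~ K w -> h' w = w.
  by move=> Kw; rewrite -[in LHS](h_out _ Kw) hK.
have h'half w : half_space R n w -> half_space R n (h' w).
  by rewrite half_spaceE /= -{1}(h'K w) h_i0.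
have h'W w : W w -> W (h' w).
  move=> Ww; have [Kw|/h'_out -> //] := pselect (K w).
  have [/KW//|/h_out] := pselect (K (h' w)).
  by rewrite h'K => <-.
pose F x := if x \in U then psi (h (phi x)) else x.
pose G x := if x \in U then psi (h' (phi x)) else x.
have FU x : U x -> F x = psi (h (phi x)) by move=> Ux; rewrite /F mem_set.
have GU x : U x -> G x = psi (h' (phi x)) by move=> Ux; rewrite /G mem_set.
have FK : cancel F G.
  move=> x; have [Ux|Ux] := pselect (U x); last first.
    by rewrite /F /G !(memNset Ux).
  have [Wx hx] := chart_image Ux.
  have [Uhx pE] := chart_inv (hW _ Wx) (hhalf _ hx).
  by rewrite FU// GU// pE hK phiK.
have GK : cancel G F.
  move=> x; have [Ux|Ux] := pselect (U x); last first.
    by rewrite /F /G !(memNset Ux).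
  have [Wx hx] := chart_image Ux.
  have [Uhx pE] := chart_inv (h'W _ Wx) (h'half _ hx).
  by rewrite GU// FU// pE h'K phiK.
pose S := psi @` (K `&` half_space R n).
have clS : closed S.
  apply: (compact_closed hM); apply: continuous_compact.
    by apply: (continuous_subspaceW _ psi_cont); exact: setSI.
  apply: (compact_closedI cK); rewrite half_spaceE.
  apply: ((continuous_closedP (fun w : 'rV[R]_n => w ord0 i0)).1 _ _
    (closed_ge (y := 0))).
  exact: coord_continuous.
have FS x : ~ S x -> F x = x.
  move=> Sx; have [Ux|Ux] := pselect (U x); last by rewrite /F memNset.
  have [Wx hx] := chart_image Ux.
  rewrite FU// h_out ?phiK// => Kx; apply: Sx; exists (phi x) => //.
  exact: phiK.
have F_cont : continuous F.
  move=> x; have [Ux|Ux] := pselect (U x); last first.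
    have Sx : ~ S x.
      move=> [w [/KW Ww hw] wx]; apply: Ux; rewrite -wx.
      by have [] := chart_inv Ww hw.
    rewrite /continuous_at FS// => A Ax.
    have : nbhs x (~` S) by apply: open_nbhs_nbhs; split=> //; exact: closed_openC.
    by apply: filterS2 Ax => y Ay Sy /=; rewrite FS.
  rewrite /continuous_at FU// => A Ax.
  have [Wx hx] := chart_image Ux.
  have near_hx := chart_inv_continuous (hW _ Wx) (hhalf _ hx) Ax.
  have := continuous_comp (chart_continuous Ux) (h_cont (phi x)) near_hx.
  have : nbhs x U by exact: open_nbhs_nbhs.
  apply: filterS2 => y Uy /= Ay; rewrite FU//; apply: Ay; apply: hhalf.
  by have [] := chart_image Uy.
have [Fh FhE] := compact_bijection_homeo hM cM F_cont FK GK.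
exists Fh; rewrite FhE; split.
  move=> w Ww hw; have [Uw pw] := chart_inv Ww hw.
  by rewrite FU// pw.
move=> x; have [[w [Kw hw] <-]|/FS] := pselect (S x); last by left.
right; exists w, (h w); have [Uw pw] := chart_inv (KW _ Kw) hw.
by rewrite FU// pw; split=> //; split; [exact: hKK|exact: hhalf].
Qed.

End half_space_chart.

(** * Pushing boundary points *)

(** A boundary point of a half-space is a limit of points of the open half-space,
    reached here along the first coordinate axis. *)
Lemma manifold_interior_dense (R : realType) (n : nat) (M : topologicalType) :
  (0 < n)%N -> manifold_with_boundary R n M -> dense (manifold_interior R n M).
Proof.
case: n => // n _ M_manifold O [x Ox] oO.
have [U [W [phi [psi [Ux UW]]]]] := manifold_chart x M_manifold.
have oW := chart_open_codom UW.
have i0E : (ord0 : 'I_n.+1) = 0%N :> nat by [].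
have [Wx hx] := chart_image UW Ux.
pose e : 'rV[R]_n.+1 := delta_mx ord0 ord0.
have near_phix : \forall w \near phi x, W w /\ (half_space R n.+1 w -> O (psi w)).
  have nW : nbhs (phi x) W by exact: open_nbhs_nbhs.
  have nO : nbhs (psi (phi x)) O by rewrite (chartK UW)//; exact: open_nbhs_nbhs.
  have near_O := chart_inv_continuous UW Wx hx nO.
  by apply: filterS2 nW near_O.
have line_cont : continuous (fun t : R => phi x + t *: e).
  move=> t; apply: (@continuousD R _ R (cst (phi x)) (fun t => t *: e)).
    exact: cst_continuous.
  exact: scalel_continuous.
have := line_cont 0; rewrite /continuous_at scale0r addr0 => /(_ _ near_phix).
move=> /nbhs_ballP[t /= t0 /(_ (t / 2))[]].
  by rewrite /ball /= sub0r normrN gtr0_norm ?divr_gt0//; lra.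
have y0 : 0 < (phi x + (t / 2) *: e) ord0 ord0.
  move: hx; rewrite (half_spaceE i0E) /= !mxE eqxx mulr1 => x0.
  by rewrite ltr_wpDl// divr_gt0.
set y := phi x + (t / 2) *: e in y0 * => Wy.
have hy : half_space R n.+1 y by rewrite (half_spaceE i0E) /= ltW.
move=> /(_ hy) Oy; have [Uy py] := chart_inv UW Wy hy.
exists (psi y); split=> //.
by apply: (chart_interior i0E UW Uy); rewrite py.
Qed.

Section boundary_push.
Context {R : realType} {n : nat} {M : topologicalType}.
Variables (i0 i1 : 'I_n) (U : set M) (W : set 'rV[R]_n) (phi : M -> 'rV[R]_n)
  (psi : 'rV[R]_n -> M).
Hypotheses (hM : hausdorff_space M) (cM : compact [set: M]).
Hypotheses (i0E : i0 = 0%N :> nat) (i01 : i0 != i1).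
Hypothesis UW : half_space_chart U W phi psi.

Let e : 'rV[R]_n := delta_mx ord0 i1.

Lemma push_chart v r sigma kappa : 0 < kappa -> 0 <= sigma <= r / 2 ->
  half_space R n v -> push_box i1 v r sigma kappa `<=` W ->
  exists F : homeo M, F (psi v) = psi (v + sigma *: e) /\
    forall x, F x = x \/ exists w w',
      [/\ push_box i1 v r sigma kappa w /\ half_space R n w, x = psi w,
          push_box i1 v r sigma kappa w' /\ half_space R n w' & F x = psi w'].
Proof.
move=> k0 sr hv boxW.
have [F [FE FK]] := chart_extension i0E UW hM cM
  (pushK i1 v r sigma kappa) (push_invK i1 v r sigma kappa)
  (@push_continuous R n i1 v r sigma kappa) (fun w => push_other v r sigma kappa w i01)
  (push_box_compact k0) boxW (@push_out R n i1 v r sigma kappa).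
exists F; split=> //; rewrite FE// ?push_center//.
apply: boxW; rewrite /push_box /= /radial /axial !subrr scale0r subr0 !normr0 mulr0.
by split; lra.
Qed.

Local Notation B := (manifold_boundary R n M).

Lemma half_spaceDe w s : half_space R n w -> half_space R n (w + s *: e).
Proof. by rewrite (half_spaceE i0E) /= !mxE (negbTE i01) andbF mulr0 addr0. Qed.

(** The push of height [s] moves [psi v] to [psi (v + s *: e)], and homeomorphisms
    preserve the boundary. *)
Lemma boundary_segment v r s : half_space R n v -> B (psi v) ->
  (forall w, `|w - v| <= r * (1 + `|e|) -> W w) -> 0 <= s <= r / 2 ->
  B (psi (v + s *: e)).
Proof.
move=> hv Bv ballW sr.
have [|F [<- _]] := push_chart (kappa := 1) ltr01 sr hv; last exact: homeo_boundary.
move=> w [+ aw]; rewrite mul1r => rw; apply: ballW.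
by apply: le_trans (norm_radial aw) _; rewrite mulrDr mulr1 lerD2r; lra.
Qed.

(** The chart pulls [O] back to a neighbourhood [Q] of the segment of the axis on
    which [axial] is at most [r] in absolute value.  By compactness, [radial] is at
    least some [delta > 0] on the part of the box outside of [Q].  The push over a
    thinner box moves [psi v] by [r / 2] and has its support in [O]. *)
Lemma boundary_push v r (O : set M) : half_space R n v -> 0 < r ->
  (forall w, `|w - v| <= r * (1 + `|e|) -> W w) -> open O ->
  (forall s, `|s| <= r -> B (psi (v + s *: e))) -> B `<=` O ->
  exists2 F : homeo M, F (psi v) = psi (v + (r / 2) *: e) &
    forall x, F x = x \/ O x /\ O (F x).
Proof.
move=> hv r0 ballW oO segB BO.
pose Q := [set w | half_space R n w -> O (psi w)].
have segQ s : `|s| <= r -> nbhs (v + s *: e) Q.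
  move=> sr; have hs := half_spaceDe s hv.
  apply: (chart_inv_continuous UW _ hs); last first.
    by apply: open_nbhs_nbhs; split=> //; exact/BO/segB.
  apply: ballW; rewrite addrAC subrr add0r normrZ mulrDr mulr1.
  by rewrite ler_wpDl ?(ltW r0)// ler_wpM2r.
pose C := push_box i1 v r r 1 `\` interior Q.
have cC : compact C.
  apply: compact_closedI; first exact: push_box_compact.
  by apply: open_closedC; exact: open_interior.
have [delta [d0 dr dQ]] : exists delta, [/\ 0 < delta, delta <= r &
    forall w, radial i1 v w < delta -> `|axial i1 v w| <= r -> Q w].
  have [C0|/set0P C0] := eqVneq C set0.
    exists r; split=> // w rw aw; have : ~ C w by rewrite C0.
    move=> Cw; apply: (@interior_subset _ Q); apply: contrapT => Qw; apply: Cw.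
    by split=> //; rewrite /push_box /= mul1r ltW.
  have [|c + c_min] := @EVT_min_rV R n (radial i1 v) C C0 cC.
    by apply: continuous_subspaceT; exact: radial_continuous.
  rewrite inE => -[[+ ac] Qc]; rewrite mul1r => rc.
  exists (radial i1 v c); split=> //.
    rewrite lt_neqAle normr_ge0 andbT; apply/eqP => /esym/normr0_eq0/eqP.
    rewrite subr_eq0 => /eqP cE; apply: Qc.
    have -> : c = v + axial i1 v c *: e by rewrite -cE addrC subrK.
    exact: segQ.
  move=> w rw aw; apply: (@interior_subset _ Q); apply: contrapT => Qw.
  have : radial i1 v c <= radial i1 v w.
    apply: c_min; rewrite inE; split=> //; rewrite /push_box /= mul1r.
    by split=> //; rewrite ltW// (lt_le_trans rw).
  by rewrite leNgt rw.
(* With this slope, the box around the axis has radius [delta / 2]. *)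
have k0 : 0 < r / delta by rewrite divr_gt0.
have box_radial w : push_box i1 v r (r / 2) (r / delta) w -> radial i1 v w < delta.
  move=> [rw _]; have : radial i1 v w <= delta / 2.
    move: rw; rewrite -mulrA ler_pM2l// mulrC ler_pdivrMr// mulrC; lra.
  by lra.
have [|w boxw|F [Fv FK]] := push_chart (v := v) (r := r) (sigma := r / 2) k0 _ hv.
- by apply/andP; split; lra.
- apply: ballW; have [_ aw] := boxw; apply: le_trans (norm_radial aw) _.
  by rewrite mulrDr mulr1 lerD2r; have := box_radial _ boxw; lra.
exists F => // x; have [|[w [w' [[bw hw] -> [bw' hw'] ->]]]] := FK x; first by left.
right; split; [have [_ aw] := bw|have [_ aw] := bw'];
  by apply: dQ => //; exact: box_radial.
Qed.

End boundary_push.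

Theorem corollary6 (R : realType) (n : nat) (M : topologicalType)
    (n_ge2 : (2 <= n)%N)
    (M_manifold : manifold_with_boundary R n M)
    (M_compact : compact [set: M])
    (boundary_nonempty : manifold_boundary R n M !=set0) :
  ~ minimal_group_topology (compact_open_topology M).
Proof.
have [hM _ _] := M_manifold; have [p Bp] := boundary_nonempty.
have [U [W [phi [psi [Up UW]]]]] := manifold_chart p M_manifold.
have oW := chart_open_codom UW.
pose i0 := Ordinal (ltnW n_ge2); pose i1 := Ordinal n_ge2.
have i0E : i0 = 0%N :> nat by [].
have i01 : i0 != i1 by [].
pose e : 'rV[R]_n := delta_mx ord0 i1; have e1 : 0 < 1 + `|e| by rewrite ltr_pwDl.
set B := manifold_boundary R n M in Bp.
have [Wp hp] := chart_image UW Up.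
have : nbhs (phi p) W by exact: open_nbhs_nbhs.
move=> /nbhs_ballP[rho /= rho0 rhoW].
pose r := rho / (1 + `|e|) / 2; have r0 : 0 < r by rewrite !divr_gt0.
have ballW w : `|w - phi p| <= r * (1 + `|e|) -> W w.
  move=> wp; apply: rhoW; rewrite -ball_normE /= distrC; apply: le_lt_trans wp _.
  by rewrite /r mulrAC divfK ?gt_eqF//; lra.
have segB s : 0 <= s <= r / 2 -> B (psi (phi p + s *: e)).
  apply: (boundary_segment hM M_compact i0E i01 UW hp _ ballW).
  by rewrite (chartK UW).
(* The segment from [phi p] to [phi p + (r / 2) *: e] consists of boundary points;
   [v] is its middle. *)
pose v := phi p + (r / 4) *: e.
have hv : half_space R n v by exact: (half_spaceDe i0E i01).
have ballWv w : `|w - v| <= r / 4 * (1 + `|e|) -> W w.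
  move=> wv; apply: ballW; rewrite -[w](subrK v) -addrA.
  apply: le_trans (ler_normD _ _) _.
  rewrite /v addrAC subrr add0r normrZ gtr0_norm ?divr_gt0//.
  have := mulr_ge0 (ltW r0) (normr_ge0 e).
  move: wv; rewrite !mulrDr !mulr1 -/v; lra.
have segBv s : `|s| <= r / 4 -> B (psi (v + s *: e)).
  by rewrite ler_norml => sr; rewrite /v -addrA -scalerDl; apply: segB; lra.
have homeoB (f : homeo M) x : B x -> B (f x) by exact: homeo_boundary.
have r40 : 0 < r / 4 by rewrite divr_gt0.
move=> [_]; apply; exists (collapsed_topology R B); split; first split.
- exact: collapsed_group_topology.
- apply: collapsed_hausdorff => //.
    by apply: open_closedC; exact: manifold_interior_open.
  by rewrite setCK; apply: manifold_interior_dense => //; exact: ltnW.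
- apply: (@collapsed_strictly_coarser R M B (psi v) (psi (v + (r / 4 / 2) *: e))) => //.
  + by rewrite -[v]addr0 -(scale0r e); apply: segBv; rewrite normr0 ltW.
  + have Wv : W v by apply: ballWv; rewrite subrr normr0 mulr_ge0// ltW.
    have Wq : W (v + (r / 4 / 2) *: e).
      apply: ballWv; rewrite addrAC subrr add0r normrZ gtr0_norm ?divr_gt0//.
      by rewrite mulrDr mulr1 ler_wpDl ?(ltW r40)// ler_wpM2r//; lra.
    have hq : half_space R n (v + (r / 4 / 2) *: e) by exact: (half_spaceDe i0E i01).
    move=> /(congr1 phi).
    have [_ ->] := chart_inv UW Wv hv; have [_ ->] := chart_inv UW Wq hq.
    move=> /(congr1 (axial i1 v))/esym/eqP.
    by rewrite axialD -subr_eq0 addrAC subrr add0r gt_eqF ?divr_gt0.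
  + move=> O oO BO.
    exact: (boundary_push hM M_compact i0E i01 UW hv r40 ballWv oO segBv BO).
Qed.
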